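(* Valla ideals are Mayer-Vietoris ideals of type $B2$. That is, for all positive integers $a\geq b$, the ideal $$I_{a,b}=\langle\, x_1^{a+b-2j}J^j\ (j=0,\dots,b-1),\quad x_1^{a-t}J^t\ (t=b,\dots,a)\,\rangle\subset \mathbf{k}[x_1,\dots,x_n],\qquad J=\langle x_2,\dots,x_n\rangle,$$ is a Mayer-Vietoris ideal of type $B2$.
   Context: $\mathbf{k}$ is a field of characteristic $0$, $R=\mathbf{k}[x_1,\dots,x_n]$ (with $n\ge 2$). Here $x_1^{c}J^j$ denotes the ideal of all products of $x_1^c$ with elements of the power $J^j$ (with $J^0=R$). Mayer-Vietoris trees: a Mayer-Vietoris tree $MVT(I)$ of a nonzero monomial ideal $I$ is a rooted binary tree whose nodes are (labelled by) monomial ideals, with root $I$. Whenever a node $L$ has minimal monomial generating set $\{m_1,\dots,m_s\}$ with $s\geq 2$, one minimal generator (the pivot monomial) is chosen, the choice being arbitrary at each node; numbering so that the pivot is $m_s$, the node $L$ has exactly two children: the left child $\tilde L=\langle m_1,\dots,m_{s-1}\rangle\cap\langle m_s\rangle=\langle \mathrm{lcm}(m_1,m_s),\dots,\mathrm{lcm}(m_{s-1},m_s)\rangle$ and the right child $L'=\langle m_1,\dots,m_{s-1}\rangle$. Nodes with a single minimal generator are leaves. Positions: the root has position $1$; left and right children of the node in position $p$ have positions $2p$ and $2p+1$. Dimensions: the root has dimension $0$; left and right children of a node of dimension $d$ have dimensions $d+1$ and $d$. A node is relevant if its position is $1$ or even. Type $B2$: for a tree $MVT(I)$ let $\widehat{\beta}_{i,\alpha}(I)$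 be the number of relevant nodes of dimension $i$ of $MVT(I)$ having $x^\alpha$ as a minimal generator, and let $\beta_{i,\alpha}(I)=\dim_{\mathbf{k}}\mathrm{Tor}^R_{i,\alpha}(I,\mathbf{k})$. $I$ is a Mayer-Vietoris ideal of type $B2$ if there is a Mayer-Vietoris tree of $I$ with $\widehat{\beta}_{i,\alpha}(I)=\beta_{i,\alpha}(I)$ for all $i\in\mathbb{N}$, $\alpha\in\mathbb{N}^n$. *)

(* Defs.v *)
From HB Require Import structures.
From mathcomp Require Import all_boot all_order all_algebra.
From mathcomp Require Import finmap.
From mathcomp Require Import mpoly.

Set Implicit Arguments.
Unset Strict Implicit.
Unset Printing Implicit Defensive.

Import GRing.Theory.

Local Open Scope ring_scope.

(** Ideals of k[x_1,...,x_n], as sets of polynomials compared extensionally. *)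

Section Ideals.
Variables (k : fieldType) (n : nat).
Local Notation R := {mpoly k[n]}.

Definition same_ideal (I K : R -> Prop) : Prop := forall p, I p <-> K p.

Definition ideal_gen (S : R -> Prop) : R -> Prop := fun p =>
  exists2 s : seq (R * R),
    forall c, c \in s -> S c.2 & p = \sum_(c <- s) c.1 * c.2.

Definition ideal_cap (I K : R -> Prop) : R -> Prop := fun p => I p /\ K p.

Definition ideal_mul (I K : R -> Prop) : R -> Prop :=
  ideal_gen (fun p => exists f g, [/\ I f, K g & p = f * g]).

Fixpoint ideal_exp (I : R -> Prop) (j : nat) : R -> Prop :=
  if j is j'.+1 then ideal_mul I (ideal_exp I j') else fun=> True.

Definition monomial_ideal (G : {fset 'X_{1..n}}) : R -> Prop :=
  ideal_gen (fun p => exists2 m, m \in G & p = 'X_[m]).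

Definition min_mongens (G : {fset 'X_{1..n}}) (I : R -> Prop) : Prop :=
  same_ideal (monomial_ideal G) I /\
  forall H : {fset 'X_{1..n}},
    (H `<` G)%fset -> ~ same_ideal (monomial_ideal H) I.

End Ideals.

Section Valla.
Variables (k : fieldType) (n : nat) (x : 'I_n).
Local Notation R := {mpoly k[n]}.

(** [x] plays the role of x_1, and J is generated by the other variables. *)
Definition vallaJ : R -> Prop :=
  ideal_gen (fun p => exists2 i : 'I_n, i != x & p = 'X_i).

Definition vallaXJ (c j : nat) : R -> Prop := fun p =>
  exists2 q, ideal_exp vallaJ j q & p = 'X_x ^+ c * q.

Definition valla_ideal (a b : nat) : R -> Prop :=
  ideal_gen (fun p =>
    (exists2 j, (j < b)%N & vallaXJ (a + b - 2 * j) j p) \/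
    (exists2 t, (b <= t <= a)%N & vallaXJ (a - t) t p)).

End Valla.

(** A node of a Mayer-Vietoris tree carries the minimal monomial generating
    set of the monomial ideal labelling it; the first subtree of an inner node
    is the left one. *)

Inductive mvtree (n : nat) : Type :=
| MVLeaf of {fset 'X_{1..n}}
| MVNode of {fset 'X_{1..n}} & mvtree n & mvtree n.

Fixpoint is_MVT (k : fieldType) (n : nat) (I : {mpoly k[n]} -> Prop)
    (t : mvtree n) : Prop :=
  match t with
  | MVLeaf G => min_mongens G I /\ #|` G|%fset = 1%N
  | MVNode G tl tr =>
      [/\ min_mongens G I, (2 <= #|` G|%fset)%N &
        exists2 m, m \in G &
          is_MVT (ideal_cap (monomial_ideal (k := k) (G `\ m)%fset)
                            (monomial_ideal [fset m]%fset)) tl /\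
          is_MVT (monomial_ideal (k := k) (G `\ m)%fset) tr]
  end.

(** The nodes of [t] as triples (position, dimension, minimal generators),
    where the root of [t] has position [p] and dimension [d]. *)
Fixpoint mv_nodes (n : nat) (p d : nat) (t : mvtree n) :
    seq (nat * nat * {fset 'X_{1..n}}) :=
  match t with
  | MVLeaf G => [:: (p, d, G)]
  | MVNode G tl tr =>
      (p, d, G) :: mv_nodes (2 * p) d.+1 tl ++ mv_nodes (2 * p + 1) d tr
  end.

Definition mv_relevant (p : nat) : bool := (p == 1%N) || ~~ odd p.

Definition mv_betti (n : nat) (t : mvtree n) (i : nat) (alpha : 'X_{1..n}) :
    nat :=
  count (fun v => [&& mv_relevant v.1.1, v.1.2 == i & alpha \in v.2])
        (mv_nodes 1 0 t).

(** N^n-graded complexes of finitely generated free modules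
      ... -> F_2 -> F_1 -> F_0 -> R,   F_i = (+)_j R(- mg_deg i j),
    with elements of F_i written as row vectors and maps acting on the
    right. *)

Section Tor.
Variables (k : fieldType) (n : nat).
Local Notation R := {mpoly k[n]}.

Record mgcomplex := MGComplex {
  mg_rk : nat -> nat;
  mg_deg : forall i, 'I_(mg_rk i) -> 'X_{1..n};
  mg_d : forall i, 'M[R]_(mg_rk i.+1, mg_rk i);
  mg_aug : 'cV[R]_(mg_rk 0)
}.

(** Maps of degree 0: every monomial of an entry accounts for the difference
    of the degrees of the two basis elements. *)
Definition mg_homogeneous (F : mgcomplex) : Prop :=
  (forall i (j : 'I_(mg_rk F i.+1)) (l : 'I_(mg_rk F i)) m,
     m \in msupp (mg_d F i j l) -> (m + mg_deg l)%MM = mg_deg j) /\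
  (forall (j : 'I_(mg_rk F 0)) m,
     m \in msupp (mg_aug F j ord0) -> m = mg_deg j).

Definition mg_resolution (F : mgcomplex) (I : R -> Prop) : Prop :=
  [/\ mg_homogeneous F,
      forall p, I p <-> exists v : 'rV_(mg_rk F 0),
        p = (v *m mg_aug F) ord0 ord0,
      forall v : 'rV_(mg_rk F 0),
        v *m mg_aug F = 0 <-> exists w, v = w *m mg_d F 0 &
      forall i (v : 'rV_(mg_rk F i.+1)),
        v *m mg_d F i = 0 <-> exists w, v = w *m mg_d F i.+1].

(** The complex F (x) k: since k = R/(x_1,...,x_n), its maps are the constant
    coefficients of those of F. *)
Definition mg_dk (F : mgcomplex) (i : nat) :
    'M[k]_(mg_rk F i.+1, mg_rk F i) :=
  map_mx (fun p : R => p@_0%MM) (mg_d F i).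

(** The row space of this diagonal matrix is (F_i (x) k)_alpha. *)
Definition mg_strand (F : mgcomplex) (i : nat) (alpha : 'X_{1..n}) :
    'M[k]_(mg_rk F i) :=
  diag_mx (\row_j (mg_deg j == alpha)%:R).

Definition mg_cycles (F : mgcomplex) (i : nat) (alpha : 'X_{1..n}) :
    'M[k]_(mg_rk F i) :=
  match i return 'M[k]_(mg_rk F i) with
  | 0 => mg_strand F 0 alpha
  | i'.+1 => (mg_strand F i'.+1 alpha :&: kermx (mg_dk F i'))%MS
  end.

Definition mg_boundaries (F : mgcomplex) (i : nat) (alpha : 'X_{1..n}) :
    'M[k]_(mg_rk F i.+1, mg_rk F i) :=
  mg_strand F i.+1 alpha *m mg_dk F i.

(** dim_k H_i(F (x) k)_alpha; the boundaries are contained in the cycles, so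
    the subtraction does not truncate. *)
Definition mg_homology_dim (F : mgcomplex) (i : nat) (alpha : 'X_{1..n}) :
    nat :=
  (\rank (mg_cycles F i alpha) - \rank (mg_boundaries F i alpha))%N.

(** [is_betti I beta] : beta i alpha = dim_k Tor^R_{i,alpha}(I,k) for all i and
    alpha, the Tor modules being computed from a graded free resolution of I;
    they do not depend on the choice of the resolution. *)
Definition is_betti (I : R -> Prop) (beta : nat -> 'X_{1..n} -> nat) : Prop :=
  exists2 F : mgcomplex, mg_resolution F I &
    forall i alpha, beta i alpha = mg_homology_dim F i alpha.

Definition MV_type_B2 (I : R -> Prop) : Prop :=
  exists2 t : mvtree n, is_MVT I t & is_betti I (mv_betti t).

End Tor.

(* Main.v *)
Require Import Defs.
From mathcomp Require Import all_boot all_order all_algebra.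
From mathcomp Require Import finmap mpoly zify.

Set Implicit Arguments.
Unset Strict Implicit.
Unset Printing Implicit Defensive.

Import GRing.Theory.
Local Open Scope ring_scope.

(** A Mayer-Vietoris tree is a recipe for a free resolution.  If m is the pivot
    of the node generated by G, the exact sequence

      0 -> <G \ m> /\ <m> -> <G \ m> (+) <m> -> <G> -> 0

    shows that <G> is resolved by the mapping cone of a comparison map from a
    resolution of the left child to a resolution of the right child
    ([mapping_cone]).  The basis of the cone consists of the basis for the right
    child, of m in homological degree 0, and of the basis for the left child
    shifted by one; this is the recursion satisfied by the relevant nodes of the
    tree ([mv_betti_node]).  Hence every tree of I yields a resolution of I in
    which the basis elements of homological degree i and multidegree alpha are
    counted by [mv_betti] ([MVT_resolution]).  If no multidegree occurs in two
    consecutive homological degrees, then all the maps vanish modulo the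
    variables, the resolution is minimal, and the counts are the Betti numbers
    ([MV_type_B2_disjoint]).

    It remains to choose a tree with this property.  Number the variables with
    x_1 first, and call a minimal generating set stable when, for every
    generator m with first variable x_p and every i > p, the monomial
    m x_i / x_p lies in the ideal.  If the lexicographically largest generator m
    is always the pivot, the left child of m is m <x_i : i > p>, whose
    descendants keep this shape ([mul_vars_MVT]).  The relevant nodes of
    dimension i therefore contain only the multidegrees m x_T with m a generator and T
    a list of i variables after the first variable of m ([stable_MVT]).  These
    are the multidegrees of the Eliahou-Kervaire resolution.

    The minimal generators of the Valla ideal are the x_1^(c_j) v with v a
    monomial of degree j in the other variables, where the exponents
    c_0 > c_1 > ... > c_a = 0 decrease strictly; this makes them stable
    ([valla_gens_stable]).  The list T above never contains x_1, so the exponent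
    of x_1 in m x_T is c_j; it determines j, and then the total degree of
    m x_T determines the length of T.  So every multidegree occurs in one
    homological degree only ([valla_length_unique]). *)

(** * Monomial ideals and their minimal generators *)

Section MonomialIdeals.
Variables (k : fieldType) (n : nat).
Local Notation R := {mpoly k[n]}.
Implicit Types (I K S : R -> Prop) (G H : {fset 'X_{1..n}}).
Implicit Types (g h m : 'X_{1..n}) (P Q : 'X_{1..n} -> Prop).

Lemma same_ideal_sym I K : same_ideal I K -> same_ideal K I.
Proof. by move=> h p; rewrite h. Qed.

Lemma same_ideal_trans I K L :
  same_ideal I K -> same_ideal K L -> same_ideal I L.
Proof. by move=> h1 h2 p; rewrite h1 h2. Qed.

Definition ideal_closed I : Prop :=
  [/\ I 0, forall p q, I p -> I q -> I (p + q) & forall r p, I p -> I (r * p)].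

Lemma ideal_gen_closed S : ideal_closed (ideal_gen S).
Proof.
split.
- by exists [::]; rewrite ?big_nil.
- move=> p q [s hs ->] [t ht ->]; exists (s ++ t); last by rewrite big_cat.
  by move=> c; rewrite mem_cat => /orP [/hs|/ht].
- move=> r p [s hs ->]; exists [seq (r * c.1, c.2) | c <- s].
    by move=> _ /mapP [c /hs h ->].
  by rewrite big_map mulr_sumr; apply: eq_bigr => c _; rewrite mulrA.
Qed.

Lemma ideal_gen_sub S p : S p -> ideal_gen S p.
Proof.
move=> h; exists [:: (1, p)]; last by rewrite big_seq1 mul1r.
by move=> c; rewrite inE => /eqP ->.
Qed.

Lemma ideal_closed_sum I (T : eqType) (s : seq T) (F : T -> R) :
  ideal_closed I -> (forall c, c \in s -> I (F c)) -> I (\sum_(c <- s) F c).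
Proof.
move=> [h0 hD _] h; rewrite big_seq.
by apply: (big_ind I) => // c /h.
Qed.

Lemma ideal_gen_min S K :
  ideal_closed K -> (forall p, S p -> K p) -> forall p, ideal_gen S p -> K p.
Proof.
move=> hK hS p [s hs ->]; apply: ideal_closed_sum => // c /hs /hS.
by case: hK => _ _; apply.
Qed.

Definition upclosed P : Prop := forall m m', P m -> P (m + m')%MM.

(** The ideal spanned by the monomials in an up-closed set. *)
Definition mon_ideal P : R -> Prop := fun p => forall m, m \in msupp p -> P m.

Lemma mon_ideal_closed P : upclosed P -> ideal_closed (mon_ideal P).
Proof.
move=> hP; split=> [m|p q hp hq m|r p hp m].
- by rewrite msupp0.
- by move/msuppD_le; rewrite mem_cat => /orP [/hp|/hq].
- move/msuppM_le/allpairsP => [[m1 m2] /= [_ h2 ->]].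
  by rewrite addmC; apply/hP/hp.
Qed.

Lemma mon_idealX P m : mon_ideal P 'X_[m] <-> P m.
Proof.
rewrite /mon_ideal msuppX; split=> [|h m']; first by apply; rewrite inE.
by rewrite inE => /eqP ->.
Qed.

Lemma mon_ideal_min P I :
  ideal_closed I -> (forall m, P m -> I 'X_[m]) -> forall p, mon_ideal P p -> I p.
Proof.
move=> hI hP p hp; rewrite (mpolyE p); apply: ideal_closed_sum => // m /hp /hP.
by rewrite -mul_mpolyC; case: hI => _ _; apply.
Qed.

Lemma mon_ideal_cap P Q :
  same_ideal (ideal_cap (mon_ideal P) (mon_ideal Q))
             (mon_ideal (fun m => P m /\ Q m)).
Proof.
move=> p; split=> [[h1 h2] m hm|h]; first by split; [apply: h1|apply: h2].
by split=> m /h [].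
Qed.

Lemma mon_ideal_same P Q :
  same_ideal (mon_ideal P) (mon_ideal Q) <-> (forall m, P m <-> Q m).
Proof.
split=> [h m|h p]; first by rewrite -!mon_idealX h.
by split=> hp m /hp /h.
Qed.

Definition upset G : 'X_{1..n} -> Prop := fun m => exists2 g, g \in G & (g <= m)%MM.

Lemma upset_upclosed G : upclosed (upset G).
Proof.
move=> m m' [g hg le]; exists g => //.
exact: lepm_trans le (lem_addr _ _).
Qed.

Lemma upset_mem G g : g \in G -> upset G g.
Proof. by move=> hg; exists g => //; apply: lepm_refl. Qed.

Lemma monomial_idealE G : same_ideal (monomial_ideal (k := k) G) (mon_ideal (upset G)).
Proof.
move=> p; split.
  apply: ideal_gen_min; first exact/mon_ideal_closed/upset_upclosed.
  by move=> _ [m hm ->]; apply/mon_idealX/upset_mem.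
apply: mon_ideal_min; first exact: ideal_gen_closed.
move=> m [g hg le]; rewrite -(submK le) mpolyXD.
have [_ _] := ideal_gen_closed (fun p : R => exists2 m, m \in G & p = 'X_[m]).
by apply; apply: ideal_gen_sub; exists g.
Qed.

Lemma monomial_ideal_closed G : ideal_closed (monomial_ideal (k := k) G).
Proof. exact: ideal_gen_closed. Qed.

Lemma monomial_ideal_same G H :
  same_ideal (monomial_ideal (k := k) G) (monomial_ideal H) <->
  (forall m, upset G m <-> upset H m).
Proof.
rewrite -mon_ideal_same; split=> h p.
  by rewrite -!monomial_idealE.
by rewrite !monomial_idealE.
Qed.

Definition antichain G : Prop :=
  forall g h, g \in G -> h \in G -> (g <= h)%MM -> g = h.

Lemma lepm_anti g h : (g <= h)%MM -> (h <= g)%MM -> g = h.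
Proof.
move=> /mnm_lepP h1 /mnm_lepP h2; apply/mnmP => i.
by apply/eqP; rewrite eqn_leq h1 h2.
Qed.

Lemma antichain_fsubset G H : (H `<=` G)%fset -> antichain G -> antichain H.
Proof. by move=> /fsubsetP hs hG g h /hs hg /hs; apply: hG. Qed.

(** Under a generator of one set lies a generator of the other, and under that
    one a generator of the first set again; the antichain condition forces the
    three to coincide. *)
Lemma antichain_upset_eq G H :
  antichain G -> antichain H -> (forall m, upset G m <-> upset H m) -> G = H.
Proof.
have aux A B : antichain A -> (forall m, upset A m <-> upset B m) ->
    forall g, g \in A -> g \in B.
  move=> hA hAB g hg.
  have [h hh le1] : upset B g by apply/hAB/upset_mem.
  have [g' hg' le2] : upset A h by apply/hAB/upset_mem.
  have e := hA _ _ hg' hg (lepm_trans le2 le1); subst g'.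
  by rewrite (lepm_anti le2 le1).
move=> hG hH e; apply/fsetP => g; apply/idP/idP; first exact: aux.
by apply: aux => // m; rewrite e.
Qed.

(** A generator divisible by another one can be left out, so a set that is
    minimal for inclusion is an antichain; conversely, an antichain and a subset
    of it that generate the same ideal are equal by [antichain_upset_eq]. *)
Lemma min_mongensP G I :
  min_mongens G I <->
  same_ideal (mon_ideal (upset G)) I /\ antichain G.
Proof.
split=> [[hG hmin]|[hG anti]].
  split; first exact: same_ideal_trans (same_ideal_sym (monomial_idealE G)) hG.
  move=> g h hg hh le; apply/eqP/negPn/negP => ne.
  apply: (hmin (G `\ h)%fset); first exact: fproperD1.
  apply: same_ideal_trans hG; apply/monomial_ideal_same => m; split.
    by move=> [u]; rewrite !inE => /andP [_ hu] hum; exists u.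
  move=> [u hu hum]; have [e|ne'] := eqVneq u h.
    exists g; first by rewrite !inE ne.
    by apply: lepm_trans le _; rewrite -e.
  by exists u => //; rewrite !inE ne'.
split; first exact: same_ideal_trans (monomial_idealE G) hG.
move=> H /[dup] hprop /fproper_sub hsub hH.
suff e : H = G by rewrite e fproperEneq eqxx in hprop.
apply: antichain_upset_eq => //; first exact: antichain_fsubset anti.
apply/monomial_ideal_same; apply: same_ideal_trans hH _.
exact: same_ideal_sym (same_ideal_trans (monomial_idealE G) hG).
Qed.

(** The ideal of a node enters only through its minimal generators. *)
Lemma is_MVT_same t I K : same_ideal I K -> is_MVT I t -> is_MVT K t.
Proof.
move=> hIK; case: t => [G|G tl tr] /= [hG hcard].
  split=> //; move: hG; rewrite !min_mongensP => -[h1 h2].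
  by split=> //; apply: same_ideal_trans hIK.
move=> hm; split=> //; move: hG; rewrite !min_mongensP => -[h1 h2].
by split=> //; apply: same_ideal_trans hIK.
Qed.

End MonomialIdeals.

(** * Mapping cones of multigraded resolutions *)

(** Step by step construction of the components of a comparison map, each of
    which depends on the previous one and has its own type. *)
Lemma dependent_choice (T : nat -> choiceType) (P : forall i, pred (T i))
    (Q : forall i, T i -> T i.+1 -> bool) :
  (exists x, P 0%N x) ->
  (forall i x, P i x -> exists y, P i.+1 y && Q i x y) ->
  exists f : forall i, T i, forall i, P i (f i) /\ Q i (f i) (f i.+1).
Proof.
move=> h0 hS.
pose step i (x : {y : T i | P i y}) : {y : T i.+1 | P i.+1 y} :=
  exist _ (xchoose (hS i _ (svalP x))) (proj1 (andP (xchooseP (hS i _ (svalP x))))).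
pose f := nat_rect (fun i => {y : T i | P i y})
  (exist (fun y => is_true (P 0%N y)) (xchoose h0) (xchooseP h0)) step.
exists (fun i => sval (f i)) => i; split; first exact: (svalP (f i)).
exact: (proj2 (andP (xchooseP (hS i (sval (f i)) (svalP (f i)))))).
Qed.

Section Homogeneous.
Variables (k : fieldType) (n : nat).
Local Notation R := {mpoly k[n]}.
Implicit Types (a b c m : 'X_{1..n}) (u v : R).

(** The component of [u] that may be the entry, in a map of degree 0, between
    a basis element of degree [a] and one of degree [b]. *)
Definition hpart a b u : R :=
  if (b <= a)%MM then u@_(a - b) *: 'X_[a - b] else 0.

Lemma hpart_supp a b u m : m \in msupp (hpart a b u) -> (m + b)%MM = a.
Proof.
rewrite /hpart; case: ifP => [le|_]; last by rewrite msupp0.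
by move/msuppZ_le; rewrite msuppX inE => /eqP ->; rewrite submK.
Qed.

Lemma hpart_id a b u :
  (forall m, m \in msupp u -> (m + b)%MM = a) -> hpart a b u = u.
Proof.
move=> h; apply/mpolyP => m.
have h0 : (m + b)%MM != a -> u@_m = 0.
  by move=> ne; apply/eqP; rewrite mcoeff_eq0; apply/negP => /h /eqP; apply/negP.
rewrite /hpart; case: ifP => [le|/negP le].
  rewrite mcoeffZ mcoeffX; have [<-|ne] := eqVneq; first by rewrite mulr1.
  rewrite mulr0 h0 //; apply: contra ne => /eqP <-.
  by rewrite addmK.
rewrite mcoeff0 h0 //; apply/eqP => e; apply: le.
by rewrite -e lem_addl.
Qed.

Lemma hpart0 a b : hpart a b 0 = 0.
Proof. by rewrite /hpart mcoeff0 scale0r if_same. Qed.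

Lemma addmAC a b c : (a + b + c)%MM = (a + c + b)%MM.
Proof. by rewrite -!addmA [(b + c)%MM]addmC. Qed.

(** A homogeneous [v] is a scalar times a single monomial, so multiplication by
    [v] only shifts the coefficients of [u]. *)
Lemma hpartM a b c u v :
  (forall m, m \in msupp v -> (m + c)%MM = b) ->
  hpart a c (u * v) = hpart a b u * v.
Proof.
move=> /hpart_id <-; rewrite {2 4}/hpart.
have [lecb|_] := boolP (c <= b)%MM; last first.
  by rewrite !mulr0 hpart0.
rewrite -!scalerAr /hpart mcoeffZ.
have [leba|nleba] := boolP (b <= a)%MM.
  have leca := lepm_trans lecb leba.
  have e : (a - c)%MM = ((b - c) + (a - b))%MM.
    by apply/(@addIm _ c); rewrite submK // addmAC submK // addmC submK.
  by rewrite leca e mcoeffMX mpolyXD -scalerAl scalerA [X in _ *: X]mulrC.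
rewrite mul0r scaler0; case: ifP => // leca.
suff -> : (u * 'X_[b - c])@_(a - c) = 0 by rewrite mulr0 scale0r.
apply/eqP; rewrite mcoeff_eq0 (perm_mem (msuppMX _ _)).
apply: contra nleba => /mapP [m' _ e].
by rewrite -(submK leca) e addmAC submK // lem_addr.
Qed.

Lemma hpartD a b u v : hpart a b (u + v) = hpart a b u + hpart a b v.
Proof. by rewrite /hpart; case: ifP; rewrite ?addr0 // mcoeffD scalerDl. Qed.

Definition mx_homog p q (a : 'I_p -> 'X_{1..n}) (b : 'I_q -> 'X_{1..n})
    (M : 'M[R]_(p, q)) : bool :=
  [forall j, forall l, all (fun m => (m + b l)%MM == a j) (msupp (M j l))].

Lemma mx_homogP p q (a : 'I_p -> 'X_{1..n}) (b : 'I_q -> 'X_{1..n})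
    (M : 'M[R]_(p, q)) :
  reflect (forall j l m, m \in msupp (M j l) -> (m + b l)%MM = a j)
          (mx_homog a b M).
Proof.
apply: (iffP forallP) => [h j l m|h j].
  by have /forallP /(_ l) /allP /[apply] /eqP := h j.
by apply/forallP => l; apply/allP => m /h ->.
Qed.

Lemma homog_mul p q r (a : 'I_p -> 'X_{1..n}) (b : 'I_q -> 'X_{1..n})
    (c : 'I_r -> 'X_{1..n}) (M : 'M[R]_(p, q)) (D : 'M[R]_(q, r)) :
  mx_homog a b M -> mx_homog b c D -> mx_homog a c (M *m D).
Proof.
move=> /mx_homogP hM /mx_homogP hD; apply/mx_homogP => j l m.
rewrite mxE => /msupp_sum_le /flattenP [_ /mapP [i _ ->]].
move=> /msuppM_le /allpairsP [[m1 m2] /= [/hM h1 /hD h2 ->]].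
by rewrite -h1 -h2 addmA.
Qed.

(** Projectivity in the graded setting: the homogeneous part of an arbitrary
    lift is again a lift, because both sides are homogeneous. *)
Lemma homog_lift p q r (a : 'I_p -> 'X_{1..n}) (b : 'I_q -> 'X_{1..n})
    (c : 'I_r -> 'X_{1..n}) (M : 'M[R]_(p, r)) (D : 'M[R]_(q, r)) :
  mx_homog a c M -> mx_homog b c D ->
  (forall j, exists w : 'rV_q, row j M = w *m D) ->
  exists N : 'M[R]_(p, q), mx_homog a b N && (N *m D == M).
Proof.
move=> /mx_homogP hM /mx_homogP hD /fin_all_exists [w hw].
exists (\matrix_(j, l) hpart (a j) (b l) (w j ord0 l)); apply/andP; split.
  by apply/mx_homogP => j l m; rewrite mxE => /hpart_supp.
apply/eqP/matrixP => j s; rewrite mxE -(hpart_id (hM j s)).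
have -> : M j s = \sum_l w j ord0 l * D l s.
  by have /rowP/(_ s) := hw j; rewrite !mxE.
rewrite (big_morph _ (hpartD _ _) (hpart0 _ _)); apply: eq_bigr => l _.
by rewrite mxE (@hpartM _ (b l)) //; apply: hD.
Qed.

End Homogeneous.

Lemma mul_rV0_mx0 (A : pzSemiRingType) p q (M : 'M[A]_(p, q)) :
  (forall v : 'rV_p, v *m M = 0) -> M = 0.
Proof. by move=> h; apply/row_matrixP => i; rewrite rowE h row0. Qed.

Section Cone.
Variables (k : fieldType) (n : nat).
Local Notation R := {mpoly k[n]}.

Lemma mg_homogeneousP (F : mgcomplex k n) :
  mg_homogeneous F <->
  (forall i, mx_homog (@mg_deg _ _ F i.+1) (@mg_deg _ _ F i) (mg_d F i)) /\
  mx_homog (@mg_deg _ _ F 0) (fun=> 0%MM) (mg_aug F).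
Proof.
split=> [[h1 h2]|[h1 h2]]; split.
- by move=> i; apply/mx_homogP => j l m; apply: h1.
- by apply/mx_homogP => j l m; rewrite ord1 addm0; apply: h2.
- by move=> i j l m; have /mx_homogP := h1 i; apply.
- by move=> j m; have /mx_homogP := h2 => /[apply]; rewrite addm0.
Qed.

Lemma mg_aug_mem (F : mgcomplex k n) I j :
  mg_resolution F I -> I (mg_aug F j ord0).
Proof.
by move=> [_ h _ _]; apply/h; exists (delta_mx ord0 j); rewrite -rowE mxE.
Qed.

Lemma mg_d_aug0 (F : mgcomplex k n) I :
  mg_resolution F I -> mg_d F 0 *m mg_aug F = 0.
Proof.
by move=> [_ _ h _]; apply: mul_rV0_mx0 => v; rewrite mulmxA; apply/h; exists v.
Qed.

Lemma mg_d_d0 (F : mgcomplex k n) I i :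
  mg_resolution F I -> mg_d F i.+1 *m mg_d F i = 0.
Proof.
by move=> [_ _ _ h]; apply: mul_rV0_mx0 => v; rewrite mulmxA; apply/h; exists v.
Qed.

Section Construction.
Variables (F G : mgcomplex k n) (A B : R -> Prop) (m : 'X_{1..n}).
Hypotheses (hF : mg_resolution F A) (hG : mg_resolution G B).
Hypothesis hB : forall p, B p <-> A p /\ exists q, p = q * 'X_[m].

(** The resolution of B, shifted by one and completed by the module generated
    by a basis element of degree [m] in homological degree 0.  Since B lies in
    <m>, its augmentation factors through X^m as [e] times X^m ([shift_aug]),
    and [e] becomes the lowest differential. *)
Definition shift_rk (i : nat) : nat := if i is i'.+1 then mg_rk G i' else 1%N.

Definition shift_deg (i : nat) : 'I_(shift_rk i) -> 'X_{1..n} :=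
  match i with 0 => fun=> m | i'.+1 => @mg_deg _ _ G i' end.

Definition shift_d (e : 'cV[R]_(mg_rk G 0)) (i : nat) :
    'M[R]_(shift_rk i.+1, shift_rk i) :=
  match i with 0 => e | i'.+1 => mg_d G i' end.

Definition cone_rk i := (mg_rk F i + shift_rk i)%N.

Definition cone_deg i (j : 'I_(cone_rk i)) : 'X_{1..n} :=
  match split j with inl l => mg_deg l | inr l => shift_deg l end.

Lemma cone_deg_lshift i (j : 'I_(mg_rk F i)) :
  @cone_deg i (lshift (shift_rk i) j) = mg_deg j.
Proof. by rewrite /cone_deg (unsplitK (inl j)). Qed.

Lemma cone_deg_rshift i (j : 'I_(shift_rk i)) :
  @cone_deg i (rshift (mg_rk F i) j) = shift_deg j.
Proof. by rewrite /cone_deg (unsplitK (inr j)). Qed.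

Definition cone_d e (phi : forall i, 'M[R]_(shift_rk i.+1, mg_rk F i)) i :
    'M[R]_(cone_rk i.+1, cone_rk i) :=
  block_mx (mg_d F i) 0 (phi i) (- shift_d e i).

Definition cone_aug : 'cV[R]_(cone_rk 0) := col_mx (mg_aug F) ('X_[m])%:M.

Definition cone e phi : mgcomplex k n :=
  MGComplex cone_deg (cone_d e phi) cone_aug.

Lemma shift_aug : exists e : 'cV[R]_(mg_rk G 0), mg_aug G = e *m ('X_[m])%:M.
Proof.
have /fin_all_exists [q hq] : forall j, exists q, mg_aug G j ord0 = q * 'X_[m].
  by move=> j; have /hB [_] := mg_aug_mem j hG.
exists (\col_j q j); apply/colP => j.
by rewrite hq mul_mx_scalar !mxE mulrC.
Qed.

Section WithAug.
Variable e : 'cV[R]_(mg_rk G 0).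
Hypothesis he : mg_aug G = e *m ('X_[m])%:M.

Lemma mul_Xm_inj q (v w : 'M[R]_(q, 1)) :
  v *m ('X_[m])%:M = w *m ('X_[m])%:M -> v = w.
Proof.
rewrite !mul_mx_scalar => /matrixP h; apply/matrixP => i j.
by have := h i j; rewrite !mxE => /mulfI -> //; rewrite -msupp_eq0 msuppX.
Qed.

Lemma shift_homog i : mx_homog (@shift_deg i.+1) (@shift_deg i) (shift_d e i).
Proof.
have [/mg_homogeneousP [hd ha] _ _ _] := hG.
case: i => [|i] /=; last exact: hd.
apply/mx_homogP => j l m' hm'; move/mx_homogP: ha => /(_ j ord0 (m + m')%MM).
rewrite addm0 addmC; apply.
rewrite he mul_mx_scalar mxE mulrC (perm_mem (msuppMX _ _)) addmC.
by rewrite mem_map; [rewrite ord1 in hm'|exact: addmI].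
Qed.

Lemma shift_exact i (v : 'rV_(shift_rk i.+1)) :
  v *m shift_d e i = 0 <-> exists w, v = w *m shift_d e i.+1.
Proof.
have [_ _ h0 h1] := hG.
case: i v => [|i] v /=; last exact: h1.
rewrite -h0 he mulmxA; split=> [->|h]; first by rewrite mul0mx.
by apply: mul_Xm_inj; rewrite h mul0mx.
Qed.

Lemma shift_d_d0 i : shift_d e i.+1 *m shift_d e i = 0.
Proof.
by apply: mul_rV0_mx0 => v; rewrite mulmxA; apply/shift_exact; exists v.
Qed.

(** Besides homogeneity, the condition under which the next component of the
    comparison map exists: in degree 0 the component covers the inclusion of B
    into A; in higher degrees its composite with the differential of G lands in
    the cycles of F. *)
Definition liftable i : pred 'M[R]_(shift_rk i.+1, mg_rk F i) := fun phi =>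
  mx_homog (@shift_deg i.+1) (@mg_deg _ _ F i) phi &&
  match i return 'M[R]_(shift_rk i.+1, mg_rk F i) -> bool with
  | 0 => fun phi => phi *m mg_aug F == mg_aug G
  | i'.+1 => fun phi => shift_d e i'.+2 *m phi *m mg_d F i' == 0
  end phi.

Lemma comparison_maps :
  exists phi : forall i, 'M[R]_(shift_rk i.+1, mg_rk F i),
    [/\ forall i, mx_homog (@shift_deg i.+1) (@mg_deg _ _ F i) (phi i),
        phi 0%N *m mg_aug F = mg_aug G &
        forall i, phi i.+1 *m mg_d F i = shift_d e i.+1 *m phi i].
Proof.
have [/mg_homogeneousP [hd ha] himg hex0 hex1] := hF.
have [/mg_homogeneousP [hd' ha'] _ _ _] := hG.
have [||phi hphi] := @dependent_choice
    (fun i => 'M[R]_(shift_rk i.+1, mg_rk F i) : choiceType) liftable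
    (fun i f g => g *m mg_d F i == shift_d e i.+1 *m f).
- have [|N /andP [hN1 hN2]] := homog_lift ha' ha.
    move=> j; have /hB [/himg [w hw] _] := mg_aug_mem j hG.
    by exists w; apply/rowP => s; rewrite !ord1 -hw !mxE.
  by exists N; rewrite /liftable /= hN1 hN2.
- move=> i f /andP [hf1 hf2].
  have hrow j : exists w, row j (shift_d e i.+1 *m f) = w *m mg_d F i.
    rewrite row_mul; case: i f hf1 hf2 j => [|i] f hf1 /eqP hf2 j.
      by apply/hex0; rewrite -mulmxA hf2 -row_mul /= (mg_d_aug0 hG) row0.
    by apply/hex1; rewrite -row_mul -row_mul hf2 row0.
  have [N /andP [hN1 /eqP hN2]] :=
    homog_lift (homog_mul (shift_homog i.+1) hf1) (hd i) hrow.
  exists N; rewrite /liftable hN1 hN2 eqxx andbT /=.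
  by rewrite -mulmxA hN2 mulmxA (shift_d_d0 i.+1) mul0mx.
- exists phi; split=> [i||i].
  + by case: (hphi i) => /andP [].
  + by case: (hphi 0%N) => /andP [_ /eqP].
  + by case: (hphi i) => _ /eqP.
Qed.

Section WithMaps.
Variable phi : forall i, 'M[R]_(shift_rk i.+1, mg_rk F i).
Hypothesis phi_homog : forall i,
  mx_homog (@shift_deg i.+1) (@mg_deg _ _ F i) (phi i).
Hypothesis phi_aug : phi 0%N *m mg_aug F = mg_aug G.
Hypothesis phi_d : forall i,
  phi i.+1 *m mg_d F i = shift_d e i.+1 *m phi i.

Lemma cone_homog : mg_homogeneous (cone e phi).
Proof.
have [/mg_homogeneousP [hd ha] _ _ _] := hF.
apply/mg_homogeneousP; split=> [i|]; apply/mx_homogP => j l m' /=.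
  rewrite /cone_d.
  case: (split_ordP j) => j' ->; case: (split_ordP l) => l' ->;
    rewrite ?cone_deg_lshift ?cone_deg_rshift.
  - by rewrite block_mxEul; move/mx_homogP: (hd i); apply.
  - by rewrite block_mxEur mxE msupp0.
  - by rewrite block_mxEdl; move/mx_homogP: (phi_homog i); apply.
  - rewrite block_mxEdr mxE (perm_mem (msuppN _)).
    by move/mx_homogP: (shift_homog i); apply.
rewrite /cone_aug; case: (split_ordP j) => j' ->.
  by rewrite cone_deg_lshift col_mxEu; move/mx_homogP: ha; apply.
by rewrite cone_deg_rshift col_mxEd !ord1 mxE eqxx mulr1n msuppX inE addm0 => /eqP.
Qed.

Lemma cone_d_d0 i : cone_d e phi i.+1 *m cone_d e phi i = 0.
Proof.
rewrite /cone_d mulmx_block !mul0mx !mulmx0 !addr0 (mg_d_d0 _ hF) add0r.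
rewrite phi_d mulNmx subrr mulNmx mulmxN opprK shift_d_d0.
exact: block_mx_const.
Qed.

Lemma cone_d_aug0 : cone_d e phi 0 *m cone_aug = 0.
Proof.
rewrite /cone_d /cone_aug mul_block_col mul0mx addr0 (mg_d_aug0 hF).
by rewrite phi_aug mulNmx he subrr col_mx0.
Qed.

(** Common end of the two exactness proofs: once the second component of a
    cycle is a boundary [w2 *m shift_d e i], the corrected first component is a
    cycle of F, hence a boundary. *)
Lemma cone_lift i (v1 : 'rV_(mg_rk F i)) (w1 : 'rV_(mg_rk F i.+1)) w2 :
  v1 + w2 *m phi i = w1 *m mg_d F i ->
  row_mx v1 (w2 *m shift_d e i) = row_mx w1 (- w2) *m cone_d e phi i.
Proof.
move=> h; rewrite /cone_d mul_row_block -h mulNmx addrK mulmx0 add0r.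
by rewrite mulmxN mulNmx opprK.
Qed.

Lemma cone_resolution :
  mg_resolution (cone e phi) (fun p => exists2 a, A a & exists q, p = a + q * 'X_[m]).
Proof.
have [_ himg hex0 hex1] := hF; have [_ himg' _ _] := hG.
split; first exact: cone_homog.
- have aug1 (v1 : 'rV_(mg_rk F 0)) (q : 'rV[R]_1) :
      (row_mx v1 q *m cone_aug) ord0 ord0 =
      (v1 *m mg_aug F) ord0 ord0 + q ord0 ord0 * 'X_[m].
    by rewrite /cone_aug mul_row_col mul_mx_scalar !mxE [X in _ + X]mulrC.
  move=> p; split.
    move=> [a /himg [v ->] [q ->]]; exists (row_mx v q%:M).
    by rewrite aug1 [q%:M _ _]mxE eqxx mulr1n.
  move=> [v ->]; rewrite -(hsubmxK v) aug1.
  exists ((lsubmx v *m mg_aug F) ord0 ord0); first by apply/himg; exists (lsubmx v).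
  by exists (rsubmx v ord0 ord0).
- move=> v; split=> [|[w ->]]; last by rewrite -mulmxA cone_d_aug0 mulmx0.
  rewrite -(hsubmxK v); move: (lsubmx v) (rsubmx v) => v1 v2.
  rewrite /= /cone_aug mul_row_col => h.
  (* By h, the element v2 X^m equals - v1 *m mg_aug F, which lies in A, and so it
     belongs to B. *)
  have [w hw] : exists w : 'rV_(mg_rk G 0), v2 = w *m e.
    have /himg' [w hw] : B ((v2 *m ('X_[m])%:M) ord0 ord0).
      apply/hB; split; last by exists (v2 ord0 ord0); rewrite mul_mx_scalar mxE mulrC.
      apply/himg; exists (- v1); congr (_ _ ord0 ord0).
      by rewrite mulNmx; apply/eqP; rewrite -addr_eq0 addrC h.
    exists w; apply: mul_Xm_inj; rewrite -mulmxA -he.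
    by apply/rowP => s; rewrite !ord1.
  have /hex0 [w1 hw1] : (v1 + w *m phi 0) *m mg_aug F = 0.
    by rewrite mulmxDl -mulmxA phi_aug he mulmxA -hw.
  by exists (row_mx w1 (- w)); rewrite hw; apply: (cone_lift hw1).
- move=> i v; split=> [|[w ->]]; last by rewrite -mulmxA /= cone_d_d0 mulmx0.
  rewrite -(hsubmxK v); move: (lsubmx v) (rsubmx v) => v1 v2.
  rewrite /= /cone_d mul_row_block mulmx0 add0r mulmxN -row_mx0.
  move=> /eq_row_mx [h1 /eqP]; rewrite oppr_eq0 => /eqP /shift_exact [w hw].
  have /hex1 [w1 hw1] : (v1 + w *m phi i.+1) *m mg_d F i = 0.
    by rewrite mulmxDl -mulmxA phi_d mulmxA -hw.
  by exists (row_mx w1 (- w)); rewrite hw; apply: (cone_lift hw1).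
Qed.

End WithMaps.
End WithAug.
End Construction.

Definition mg_count (F : mgcomplex k n) i alpha : nat :=
  #|[pred j : 'I_(mg_rk F i) | mg_deg j == alpha]|.

Lemma cone_count F G m e phi i alpha :
  mg_count (@cone F G m e phi) i alpha =
  (mg_count F i alpha +
   (if i is i'.+1 then mg_count G i' alpha else (m == alpha)))%N.
Proof.
rewrite /mg_count -!sum1_card /= big_mkcond /= /cone_rk big_split_ord /=.
congr addn.
  rewrite [RHS]big_mkcond /=; apply: eq_bigr => j _.
  by rewrite /in_mem /= cone_deg_lshift.
transitivity (\sum_(j < shift_rk G i) if shift_deg m j == alpha then 1 else 0)%N.
  by apply: eq_bigr => j _; rewrite /in_mem /= cone_deg_rshift.
case: i => [|i] /=; last by rewrite -sum1_card [RHS]big_mkcond.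
by rewrite big_ord1; case: eqP.
Qed.

(** The mapping cone for 0 -> B -> A (+) <m> -> A + <m> -> 0, where B is the
    intersection of A and <m>. *)
Lemma mapping_cone F G A B m :
  mg_resolution F A -> mg_resolution G B ->
  (forall p, B p <-> A p /\ exists q, p = q * 'X_[m]) ->
  exists2 C, mg_resolution C (fun p => exists2 a, A a & exists q, p = a + q * 'X_[m]) &
    forall i alpha, mg_count C i alpha =
      (mg_count F i alpha +
       (if i is i'.+1 then mg_count G i' alpha else (m == alpha)))%N.
Proof.
move=> hF hG hB; have [e he] := shift_aug hG hB.
have [phi [h1 h2 h3]] := comparison_maps hF hG hB he.
exists (cone m e phi); first exact: (cone_resolution hF hG).
exact: cone_count.
Qed.

End Cone.

(** * The resolution given by a Mayer-Vietoris tree *)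

Section MVResolution.
Variables (k : fieldType) (n : nat).
Local Notation R := {mpoly k[n]}.
Implicit Types (t : mvtree n) (G : {fset 'X_{1..n}}) (alpha m : 'X_{1..n}).

Definition mv_root t : {fset 'X_{1..n}} :=
  match t with MVLeaf G => G | MVNode G _ _ => G end.

(** The contribution of all relevant nodes below the root.  Positions can be
    forgotten: below a root in any positive position, the relevant nodes are
    exactly the left children. *)
Fixpoint nonroot_betti t (i : nat) alpha : nat :=
  if t is MVNode _ tl tr then
    (if i is i'.+1 then
       ((i' == 0) && (alpha \in mv_root tl)) + nonroot_betti tl i' alpha
     else 0) + nonroot_betti tr i alpha
  else 0.

(** The position 2p + 1 of a right child is odd and not 1, while 2p is even, so
    the relevance of the nodes below the root is independent of p > 0. *)
Lemma count_mv_nodes t p d i alpha : (0 < p)%N ->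
  count (fun v => [&& mv_relevant v.1.1, v.1.2 == i & alpha \in v.2])
        (mv_nodes p d t) =
  ([&& mv_relevant p, d == i & alpha \in mv_root t] +
   (if (d <= i)%N then nonroot_betti t (i - d) alpha else 0))%N.
Proof.
elim: t p d => [G|G tl IHl tr IHr] p d p_gt0 /=; first by rewrite if_same addn0.
congr addn; rewrite count_cat IHl ?muln_gt0 // IHr ?addn_gt0 ?muln_gt0 ?p_gt0 //.
have -> : mv_relevant (2 * p + 1) = false.
  by rewrite /mv_relevant; move: p_gt0; lia.
have -> : mv_relevant (2 * p) by rewrite /mv_relevant; lia.
rewrite add0n /=; case: (ltngtP d i) => [lt|gt|->] /=.
- rewrite (_ : i - d = (i - d.+1).+1)%N; last by lia.
  by congr (((_ && _) + _) + _)%N; lia.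
- by rewrite (gtn_eqF (leqW gt)).
- by rewrite subnn (gtn_eqF (ltnSn i)).
Qed.

Lemma mv_bettiE t i alpha :
  mv_betti t i alpha =
  (((i == 0) && (alpha \in mv_root t)) + nonroot_betti t i alpha)%N.
Proof. by rewrite /mv_betti count_mv_nodes //= subn0 [0%N == i]eq_sym. Qed.

Lemma is_MVT_root (I : R -> Prop) t : is_MVT I t -> min_mongens (mv_root t) I.
Proof. by case: t => [G|G tl tr] []. Qed.

(** The root generators are those of the right child and the pivot, by
    uniqueness of minimal generators, and the left child counts one dimension
    higher: the same recursion as for the ranks in [mapping_cone]. *)
Lemma mv_betti_node (I : R -> Prop) G tl tr m i alpha :
  min_mongens G I -> m \in G ->
  is_MVT (monomial_ideal (k := k) (G `\ m)%fset) tr ->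
  mv_betti (MVNode G tl tr) i alpha =
  (mv_betti tr i alpha +
   (if i is i'.+1 then mv_betti tl i' alpha else (m == alpha)))%N.
Proof.
move=> /min_mongensP [_ anti] hm /is_MVT_root /min_mongensP [hr antir].
have -> := mv_bettiE (MVNode G tl tr) i alpha.
have er : mv_root tr = (G `\ m)%fset.
  apply: antichain_upset_eq => //.
    by apply: antichain_fsubset anti; apply: fsubsetDl.
  apply/(mon_ideal_same k); apply: same_ideal_trans hr _; exact: monomial_idealE.
rewrite !mv_bettiE er; case: i => [|i] /=; last by rewrite add0n addnC mv_bettiE.
rewrite !in_fsetE add0n [RHS]addnAC; congr addn.
have [->|_] := eqVneq alpha m; first by rewrite hm.
by rewrite addn0.
Qed.

Definition zero_complex : mgcomplex k n :=
  @MGComplex k n (fun=> 0%N) (fun=> fun=> 0%MM) (fun=> 0) 0.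

Lemma zero_resolution : mg_resolution zero_complex (fun p : R => p = 0).
Proof.
split=> [|p|v|i v] /=.
- by split=> [i []|[]].
- by split=> [->|[v ->]]; [exists 0; rewrite mulmx0 mxE|rewrite mulmx0 mxE].
- by rewrite !mulmx0; split=> // _; exists 0; rewrite mulmx0 thinmx0.
- by rewrite !mulmx0; split=> // _; exists 0; rewrite mulmx0 thinmx0.
Qed.

Lemma zero_count i alpha : mg_count zero_complex i alpha = 0%N.
Proof. by apply: eq_card0 => -[]. Qed.

Lemma mg_resolution_same (F : mgcomplex k n) (I K : R -> Prop) :
  same_ideal I K -> mg_resolution F I -> mg_resolution F K.
Proof. by move=> hIK [h1 h2 h3 h4]; split=> // p; rewrite -hIK. Qed.

Lemma monomial_ideal1P m (p : R) :
  monomial_ideal [fset m]%fset p <-> exists q, p = q * 'X_[m].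
Proof.
split=> [|[q ->]].
  apply: (ideal_gen_min (K := fun p => exists q, p = q * 'X_[m])) =>
    [|_ [m' /fset1P -> ->]]; last by exists 1; rewrite mul1r.
  split; first by exists 0; rewrite mul0r.
    by move=> _ _ [q1 ->] [q2 ->]; exists (q1 + q2); rewrite mulrDl.
  by move=> r _ [q ->]; exists (r * q); rewrite mulrA.
case: (monomial_ideal_closed k [fset m]%fset) => _ _; apply.
by apply: ideal_gen_sub; exists m => //; rewrite inE.
Qed.

Lemma monomial_idealD1 G m : m \in G ->
  same_ideal (fun p : R => exists2 a, monomial_ideal (G `\ m)%fset a &
                           exists q, p = a + q * 'X_[m])
             (monomial_ideal G).
Proof.
move=> hm p; split.
  have [_ hD hM] := monomial_ideal_closed k G.
  have hgen m' : m' \in G -> monomial_ideal (k := k) G 'X_[m'].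
    by move=> h; apply: ideal_gen_sub; exists m'.
  move=> [a ha [q ->]]; apply: hD; last exact/hM/hgen.
  move: ha; apply: ideal_gen_min => [|_ [m' hm' ->]]; first exact: ideal_gen_closed.
  by apply: hgen; move: hm'; rewrite !inE => /andP [].
have [h0 hD hM] := monomial_ideal_closed k (G `\ m)%fset.
apply: (ideal_gen_min (K := fun p => exists2 a, monomial_ideal (G `\ m)%fset a &
  exists q, p = a + q * 'X_[m])) => [|_ [m' hm' ->]].
  split; first by exists 0 => //; exists 0; rewrite mul0r addr0.
  - move=> _ _ [a1 h1 [q1 ->]] [a2 h2 [q2 ->]]; exists (a1 + a2); first exact: hD.
    by exists (q1 + q2); rewrite mulrDl addrACA.
  - move=> r _ [a h [q ->]]; exists (r * a); first exact: hM.
    by exists (r * q); rewrite mulrDr mulrA.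
have [->|ne] := eqVneq m' m.
  by exists 0 => //; exists 1; rewrite add0r mul1r.
exists 'X_[m']; last by exists 0; rewrite mul0r addr0.
by apply: ideal_gen_sub; exists m' => //; rewrite !inE ne.
Qed.

(** Induction on the tree; a leaf <m> is the cone over two copies of the zero
    complex, an inner node the cone over the resolutions of its children. *)
Lemma MVT_resolution t (I : R -> Prop) :
  is_MVT I t ->
  exists2 F, mg_resolution F I & forall i alpha, mg_count F i alpha = mv_betti t i alpha.
Proof.
elim: t I => [G|G tl IHl tr IHr] I /=.
  move=> [/min_mongensP [hG _] /eqP /cardfs1P [m eG]]; subst G.
  have [p|F hF hcount] :=
    @mapping_cone k n _ _ _ (fun p => p = 0) m zero_resolution zero_resolution.
    by split=> [->|[]] //; split=> //; exists 0; rewrite mul0r.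
  exists F.
    apply: mg_resolution_same hF => p; rewrite -hG -monomial_idealE.
    rewrite monomial_ideal1P; split=> [[_ -> [q ->]]|[q ->]].
      by exists q; rewrite add0r.
    by exists 0 => //; exists q; rewrite add0r.
  move=> i alpha; rewrite hcount mv_bettiE /= addn0 in_fset1.
  by rewrite zero_count add0n eq_sym; case: i => [|i] //=; rewrite zero_count.
move=> [hG _ [m hm [hl hr]]].
have [Fl hFl cl] := IHl _ hl; have [Fr hFr cr] := IHr _ hr.
have [p|F hF hcount] := @mapping_cone k n Fr Fl _ _ m hFr hFl.
  by rewrite /ideal_cap monomial_ideal1P.
exists F.
  apply: mg_resolution_same hF.
  by apply: same_ideal_trans (monomial_idealD1 hm) _; case: hG.
move=> i alpha; rewrite hcount (mv_betti_node _ _ _ hG hm hr) cr.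
by case: i => [|i]; rewrite ?cl.
Qed.

(** A diagonal 0/1 matrix is E^T E, where E consists of the rows of the
    identity at the selected positions, and E E^T = 1. *)
Lemma rank_strand (F : mgcomplex k n) i alpha :
  \rank (mg_strand F i alpha) = mg_count F i alpha.
Proof.
set S := [set j : 'I_(mg_rk F i) | mg_deg j == alpha].
have -> : mg_count F i alpha = #|S| by rewrite cardsE.
pose E : 'M[k]_(#|S|, mg_rk F i) := rowsub (@enum_val _ (mem S)) 1%:M.
have EET : E *m E^T = 1%:M.
  apply/matrixP => j l; rewrite !mxE (bigD1 (enum_val j)) //= big1 => [|s ne].
    by rewrite !mxE eqxx mul1r addr0 eq_sym (inj_eq enum_val_inj) eq_sym.
  by rewrite !mxE eq_sym (negPf ne) mul0r.
have ETE : mg_strand F i alpha = E^T *m E.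
  apply/matrixP => j l; rewrite !mxE.
  have [hj|hj] := boolP (mg_deg j == alpha).
    have hjS : j \in S by rewrite inE.
    rewrite (bigD1 (enum_rank_in hjS j)) //= big1 => [|s ne].
      by rewrite !mxE enum_rankK_in // eqxx mul1r addr0.
    rewrite !mxE; case: eqP => [e|]; last by rewrite mul0r.
    case/eqP: ne; apply: enum_val_inj; rewrite e enum_rankK_in //.
  rewrite mul0rn big1 // => s _; rewrite !mxE.
  case: eqP => [e|]; last by rewrite mul0r.
  by move: (enum_valP s); rewrite e inE (negPf hj).
apply/eqP; rewrite eqn_leq ETE; apply/andP; split.
  exact: leq_trans (mulmx_max_rank _ _) _.
rewrite -[X in (X <= _)%N](mxrank1 k) -EET -[E in X in (X <= _)%N]mul1mx -EET.
rewrite -[E *m E^T *m E]mulmxA -mulmxA.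
exact: leq_trans (mxrankM_maxr _ _) (mxrankM_maxl _ _).
Qed.

(** A nonzero constant term in an entry of a differential would force the two
    basis elements to have the same degree; so the complex tensored with [k] has
    zero differentials and its homology is the complex itself. *)
Lemma minimal_betti (F : mgcomplex k n) (I : R -> Prop) i alpha :
  mg_resolution F I ->
  (forall i (j : 'I_(mg_rk F i.+1)) (l : 'I_(mg_rk F i)), mg_deg j != mg_deg l) ->
  mg_homology_dim F i alpha = mg_count F i alpha.
Proof.
move=> [[hd _] _ _ _] hne.
have dk0 i' : mg_dk F i' = 0.
  apply/matrixP => j l; rewrite !mxE; apply/eqP; rewrite mcoeff_eq0.
  by apply: contra (hne i' j l) => /hd; rewrite add0m => ->.
rewrite /mg_homology_dim /mg_boundaries dk0 mulmx0 mxrank0 subn0 -rank_strand.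
case: i => [|i] //=.
by apply/eqmx_rank/eqmxP/capmx_idPl; rewrite dk0; apply/sub_kermxP; rewrite mulmx0.
Qed.

Lemma MV_type_B2_disjoint t (I : R -> Prop) :
  is_MVT I t ->
  (forall i alpha, (0 < mv_betti t i.+1 alpha)%N -> mv_betti t i alpha = 0%N) ->
  MV_type_B2 I.
Proof.
move=> ht hdisj; have [F hF hcount] := MVT_resolution ht.
exists t => //; exists F => // i alpha.
rewrite -hcount (minimal_betti _ _ hF) // => i' j l; apply/negP => /eqP e.
have := hdisj i' (mg_deg j); rewrite -!hcount.
have -> : (0 < mg_count F i'.+1 (mg_deg j))%N.
  by apply/card_gt0P; exists j; rewrite inE.
move=> /(_ isT) /eqP; rewrite -leqn0 leqNgt => /negP; apply.
by apply/card_gt0P; exists l; rewrite inE e.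
Qed.

End MVResolution.

(** * Trees of stable monomial ideals *)

Section StableTree.
Variables (k : fieldType) (n : nat).
Implicit Types (t : mvtree n) (G L : {fset 'X_{1..n}}) (alpha m w : 'X_{1..n}).
Implicit Types (s T : seq 'I_n) (i j p q : 'I_n).

Lemma left_child_same G L m :
  (forall alpha, upset G alpha /\ (m <= alpha)%MM <-> upset L alpha) ->
  same_ideal (monomial_ideal (k := k) L)
    (ideal_cap (monomial_ideal G) (monomial_ideal [fset m]%fset)).
Proof.
move=> h; apply: same_ideal_trans (monomial_idealE L) _ => p.
rewrite /ideal_cap !monomial_idealE.
apply: iff_trans (iff_sym (mon_ideal_cap (upset G) (upset [fset m]%fset) p)).
move: p; apply/mon_ideal_same => alpha; rewrite -h.
split=> -[hG hm]; split=> //; first by exists m => //; rewrite inE.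
by move: hm => [_ /fset1P ->].
Qed.

Lemma is_MVT_leaf m :
  is_MVT (monomial_ideal (k := k) [fset m]%fset) (MVLeaf [fset m]%fset).
Proof.
split; last exact: cardfs1.
apply/min_mongensP; split; first exact/same_ideal_sym/monomial_idealE.
by move=> g h /fset1P -> /fset1P ->.
Qed.

Lemma is_MVT_node G m tl tr L :
  antichain G -> m \in G -> (1 < #|` G|)%N ->
  (forall alpha, upset (G `\ m)%fset alpha /\ (m <= alpha)%MM <-> upset L alpha) ->
  is_MVT (monomial_ideal (k := k) L) tl ->
  is_MVT (monomial_ideal (k := k) (G `\ m)%fset) tr ->
  is_MVT (monomial_ideal (k := k) G) (MVNode G tl tr) /\
  forall (i : nat) alpha, mv_betti (MVNode G tl tr) i alpha =
    (mv_betti tr i alpha +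
     (if i is i'.+1 then mv_betti tl i' alpha else (m == alpha)))%N.
Proof.
move=> anti hm hcard hL htl htr.
have hG : min_mongens G (monomial_ideal (k := k) G).
  by apply/min_mongensP; split=> //; apply/same_ideal_sym/monomial_idealE.
split; last by move=> i alpha; apply: mv_betti_node hG hm htr.
split=> //; exists m => //; split=> //.
by apply: is_MVT_same htl; apply: left_child_same.
Qed.

Definition mul_vars m s : {fset 'X_{1..n}} := [fset (m + U_(i))%MM | i in s]%fset.

Lemma upset_mul_vars m s alpha :
  upset (mul_vars m s) alpha <-> exists2 i, i \in s & (m + U_(i) <= alpha)%MM.
Proof.
split=> [[_ /imfsetP [i /= hi ->]]|[i hi le]]; first by exists i.
by exists (m + U_(i))%MM => //; apply/imfsetP; exists i.
Qed.

Lemma addm_varI m : injective (fun i => (m + U_(i))%MM).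
Proof. by move=> i j /addmI /eqP; rewrite eq_mnm1 => /eqP. Qed.

Lemma lepm_var m i alpha :
  (m + U_(i) <= alpha)%MM = (m <= alpha)%MM && (m i < alpha i)%N.
Proof.
apply/mnm_lepP/andP => [h|[/mnm_lepP h hi] j].
  split; last by have := h i; rewrite mnmDE mnm1E eqxx addn1.
  by apply/mnm_lepP => j; apply: leq_trans (h j); rewrite mnmDE leq_addr.
rewrite mnmDE mnm1E; case: eqP => [<-|_]; first by rewrite addn1.
by rewrite addn0.
Qed.

Lemma mul_vars_antichain m s : antichain (mul_vars m s).
Proof.
move=> _ _ /imfsetP [i /= _ ->] /imfsetP [j /= _ ->].
rewrite lepm_var mnmDE mnm1E => /andP [_].
by case: eqP => [->|]; rewrite ?addn0 ?ltnn.
Qed.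

(** With x_h as first element of [s], the pivot m x_h has left child
    (m x_h) <x_i : i in the rest of s> and right child m <x_i : i in the rest
    of s>: both have the same shape, with a shorter list. *)
Lemma mul_vars_MVT s m :
  uniq s -> s != [::] ->
  exists2 t, is_MVT (monomial_ideal (k := k) (mul_vars m s)) t &
    forall (i : nat) alpha, (0 < mv_betti t i alpha)%N ->
      exists T, [/\ size T = i.+1, {subset T <= s} &
                    alpha = (m + \sum_(j <- T) U_(j))%MM].
Proof.
elim: s m => // h s IH m /= /andP [hs us] _.
have [e|sn0] := eqVneq s [::].
  subst s; have -> : mul_vars m [:: h] = [fset (m + U_(h))%MM]%fset.
    apply/fsetP => u; rewrite inE; apply/imfsetP/eqP => [[i /=]|->].
      by rewrite inE => /eqP ->.
    by exists h => //=; rewrite inE eqxx.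
  exists (MVLeaf [fset (m + U_(h))%MM]%fset); first exact: is_MVT_leaf.
  move=> i alpha; rewrite mv_bettiE /= addn0 inE lt0b => /andP [/eqP -> /eqP ->].
  by exists [:: h]; split=> //; rewrite big_seq1.
have hD : (mul_vars m (h :: s) `\ (m + U_(h))%MM)%fset = mul_vars m s.
  apply/fsetP => u; rewrite !inE; apply/andP/imfsetP => [[ne /imfsetP [i /=]]|].
    rewrite inE => /orP [/eqP -> e|hi ->]; first by rewrite e eqxx in ne.
    by exists i.
  move=> [i /= hi ->]; split; last by apply/imfsetP; exists i; rewrite //= inE hi orbT.
  by apply: contra hs => /eqP /addm_varI <-.
have hm : (m + U_(h))%MM \in mul_vars m (h :: s).
  by apply/imfsetP; exists h; rewrite //= inE eqxx.
have [tl htl bl] := IH (m + U_(h))%MM us sn0.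
have [tr htr br] := IH m us sn0.
have hcard : (1 < #|` mul_vars m (h :: s)|)%N.
  rewrite (cardfsD1 (m + U_(h))%MM) hm hD add1n ltnS cardfs_gt0.
  case: s sn0 {IH us hs hD hm htl htr bl br} => // i s _.
  apply/fset0Pn; exists (m + U_(i))%MM; apply/imfsetP; exists i => //=.
  by rewrite inE eqxx.
rewrite -hD in htr.
have [|ht hb] :=
  is_MVT_node (@mul_vars_antichain m (h :: s)) hm hcard _ htl htr.
  move=> alpha; rewrite hD !upset_mul_vars; split.
    move=> [[i hi]]; rewrite !lepm_var => /andP [le lti] /andP [_ lth].
    exists i => //; rewrite lepm_var lepm_var le lth !mnmDE mnm1E.
    case: eqP => [e|_]; first by rewrite e hi in hs.
    by rewrite addn0.
  move=> [i hi]; rewrite lepm_var lepm_var mnmDE => /andP [/andP [le lth] lti].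
  split; last by rewrite le lth.
  by exists i => //; rewrite lepm_var le; apply: leq_ltn_trans lti; apply: leq_addr.
exists (MVNode (mul_vars m (h :: s)) tl tr) => // d alpha.
rewrite hb addn_gt0 => /orP [/br [T [h1 h2 ->]]|].
  by exists T; split=> // j /h2; rewrite inE orbC => ->.
case: d => [|d].
  rewrite lt0b => /eqP <-; exists [:: h]; rewrite big_seq1; split=> // j.
  by rewrite !inE => ->.
move=> /bl [T [h1 h2 ->]]; exists (h :: T); split=> /=; first by rewrite h1.
  by move=> j; rewrite !inE => /orP [->|/h2 ->] //; rewrite orbT.
by rewrite big_cons addmA.
Qed.

Definition mlex w m : Prop :=
  exists2 q : 'I_n, forall j : 'I_n, (j < q)%N -> w j = m j & (w q < m q)%N.

Lemma mlex_max G : G != fset0 ->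
  exists2 m, m \in G & forall w, w \in G -> w != m -> mlex w m.
Proof.
move=> /fset0Pn [g hg].
pose f (u : G) : n.-tuplelexi nat := multinom_val (val u).
case: (@Order.TotalTheory.arg_maxP _ _ G [` hg]%fset predT f isT) => u _ hu.
exists (val u); first exact: valP.
move=> w hw ne; have : (f [` hw]%fset <= f u)%O := hu _ isT.
rewrite Order.POrderTheory.le_eqVlt => /orP [/eqP e|].
  by case/eqP: ne; apply/val_inj.
case/Order.TupleLexiOrder.ltxi_tuplePlt => q h1 h2.
by exists q.
Qed.

(** Induction on the number of generators, the pivot being the lexicographic
    maximum m.  The stability hypothesis is stated with a lexicographically
    smaller witness, so that removing the maximum never removes a witness and
    the hypothesis passes to the right child.  The left child is m <x_i : i in S>, where S
    is the set of variables after the first variable x_p of m: stability shows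
    that each m x_i lies in the ideal of the other generators.  Conversely, let
    another generator w divide alpha, a multiple of m, and suppose that
    alpha / m contains only variables up to x_p.  As w precedes m, its exponents
    up to p are at most those of m, and those after p are at most those of
    alpha, that is, of m; then w divides m, which is impossible. *)
Lemma lex_stable_MVT G :
  G != fset0 -> antichain G ->
  (forall m, m \in G -> forall p i, (p < i)%N -> m p != 0%N ->
     (forall q, (q < p)%N -> m q = 0%N) ->
     exists w, [/\ w \in G, mlex w m & (w <= m + U_(i))%MM]) ->
  exists2 t, is_MVT (monomial_ideal (k := k) G) t &
    forall (i : nat) alpha, (0 < mv_betti t i alpha)%N ->
      exists m T, [/\ m \in G, size T = i, alpha = (m + \sum_(j <- T) U_(j))%MM &
                      forall j, j \in T -> exists2 p : 'I_n, (p < j)%N & m p != 0%N].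
Proof.
move eN: #|` G| => N; elim: N G eN => [G /eqP|N IH G eN G0 anti hst].
  by rewrite cardfs_eq0 => ->.
have [m hm mmax] := mlex_max G0.
have [/eqP|G'0] := eqVneq (G `\ m)%fset fset0.
  rewrite fsetD_eq0 fsubset1 (negPf G0) orbF => /eqP ->.
  exists (MVLeaf [fset m]%fset); first exact: is_MVT_leaf.
  move=> i alpha; rewrite mv_bettiE /= addn0 inE lt0b => /andP [/eqP -> /eqP ->].
  by exists m, [::]; rewrite big_nil addm0 inE.
pose S := [seq i : 'I_n <- enum 'I_n | [exists p : 'I_n, (p < i)%N && (m p != 0%N)]].
have memS (i : 'I_n) : i \in S -> exists2 p : 'I_n, (p < i)%N & m p != 0%N.
  by rewrite mem_filter => /andP [/existsP [p /andP [h1 h2]] _]; exists p.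
have hleft alpha : upset (G `\ m)%fset alpha /\ (m <= alpha)%MM <->
                   upset (mul_vars m S) alpha.
  rewrite upset_mul_vars; split=> [[[w]]|[i /memS [p0 lt0 hp0]]].
    rewrite !inE => /andP [ne hw] wa ma.
    have [/hasP [i hi lti]|/hasPn hS] := boolP (has (fun i => m i < alpha i)%N S).
      by exists i => //; rewrite lepm_var ma.
    case/eqP: (ne); apply: anti => //; apply/mnm_lepP => i.
    have [hi|hi] := boolP (i \in S).
      by move/mnm_lepP: wa => /(_ i) /leq_trans; apply; rewrite leqNgt hS.
    have [q hq ltq] := mmax w hw ne.
    case: (ltngtP i q) => [/hq -> //|lt|/val_inj -> //]; last exact: ltnW.
    case/negP: hi; rewrite mem_filter mem_enum andbT; apply/existsP; exists q.
    by rewrite lt -lt0n (leq_ltn_trans _ ltq).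
  rewrite lepm_var => /andP [ma lti]; split=> //.
  case: (arg_minnP (P := fun p => m p != 0%N) (fun p : 'I_n => p) hp0) => p hp pmin.
  have [||w [hw hlex le]] := hst m hm p i _ hp.
  - exact: leq_ltn_trans (pmin _ hp0) lt0.
  - move=> q ltq; apply/eqP; apply: contraLR ltq => /pmin.
    by rewrite -leqNgt.
  exists w; last by apply: lepm_trans le _; rewrite lepm_var ma.
  rewrite !inE hw andbT; apply/eqP => e; case: hlex => q _.
  by rewrite e ltnn.
have S0 : S != [::].
  have [w hw] := fset0Pn _ G'0.
  have [] := (proj1 (hleft (mlcm w m))).
    by split; [exists w; rewrite ?lem_mlcml|rewrite lem_mlcmr].
  by move=> _ /imfsetP [i /= hi _] _; apply: contraTneq hi => ->.
have [|||tr htr br] := IH (G `\ m)%fset _ G'0.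
- by move: eN; rewrite (cardfsD1 m) hm => -[].
- by apply: antichain_fsubset anti; apply: fsubsetDl.
- move=> m' /[!inE] /andP [ne hm'] p i lt hp hq.
  have [w [hw hlex le]] := hst _ hm' _ _ lt hp hq.
  exists w; split=> //; rewrite !inE hw andbT; apply/eqP => e; subst w.
  have [q1 h1 lt1] := hlex; have [q2 h2 lt2] := mmax _ hm' ne.
  case: (ltngtP q1 q2) => [/h2|/h1|/val_inj] e.
  + by rewrite e ltnn in lt1.
  + by rewrite e ltnn in lt2.
  + by subst q2; move: (ltn_trans lt1 lt2); rewrite ltnn.
have uS : uniq S by rewrite filter_uniq ?enum_uniq.
have [tl htl bl] := mul_vars_MVT m uS S0.
have hcard : (1 < #|` G|)%N by rewrite (cardfsD1 m) hm add1n ltnS cardfs_gt0.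
have [ht hb] := is_MVT_node anti hm hcard hleft htl htr.
exists (MVNode G tl tr) => // d alpha.
rewrite hb addn_gt0 => /orP [/br [m' [T [hm' h1 h2 h3]]]|].
  by exists m', T; split=> //; move: hm'; rewrite !inE => /andP [].
case: d => [|d].
  by rewrite lt0b => /eqP <-; exists m, [::]; rewrite big_nil addm0.
move=> /bl [T [h1 h2 h3]]; exists m, T; split=> // j /h2 /memS //.
Qed.

(** A generator dividing m x_i / x_p is lexicographically smaller than m, its
    exponents before p being zero and the one at p being less than that of
    m. *)
Lemma stable_MVT G :
  G != fset0 -> antichain G ->
  (forall m, m \in G -> forall p i, (p < i)%N -> m p != 0%N ->
     (forall q, (q < p)%N -> m q = 0%N) -> upset G (m + U_(i) - U_(p))%MM) ->
  exists2 t, is_MVT (monomial_ideal (k := k) G) t &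
    forall (i : nat) alpha, (0 < mv_betti t i alpha)%N ->
      exists m T, [/\ m \in G, size T = i, alpha = (m + \sum_(j <- T) U_(j))%MM &
                      forall j, j \in T -> exists2 p : 'I_n, (p < j)%N & m p != 0%N].
Proof.
move=> G0 anti hst; apply: lex_stable_MVT => // m hm p i ltpi hp hq.
have [w hw le] := hst _ hm _ _ ltpi hp hq; exists w; split=> //.
  move/mnm_lepP: le => le; exists p => [j ltj|].
    apply/eqP; rewrite hq // -leqn0; apply: leq_trans (le j) _.
    rewrite !(mnmBE, mnmDE, mnm1E) hq //.
    by rewrite (_ : i == j = false) // -val_eqE /= gtn_eqF // (ltn_trans ltj).
  apply: leq_ltn_trans (le p) _; rewrite !(mnmBE, mnmDE, mnm1E) eqxx.
  rewrite (_ : i == p = false) ?addn0; last by rewrite -val_eqE /= (gtn_eqF ltpi).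
  by rewrite subn1 prednK // lt0n.
exact: lepm_trans le (lem_subr _ _).
Qed.

End StableTree.

(** * Valla ideals *)

Section Valla.
Variables (k : fieldType) (n : nat) (x : 'I_n).
Local Notation R := {mpoly k[n]}.
Implicit Types (m g : 'X_{1..n}).

(** The degree in the variables other than [x]; J^j is spanned by the monomials
    for which it is at least j. *)
Definition off_deg m : nat := (\sum_(i < n | i != x) m i)%N.

Lemma mdeg_off m : mdeg m = (m x + off_deg m)%N.
Proof. by rewrite mdegE (bigD1 x). Qed.

Lemma off_degD m g : off_deg (m + g) = (off_deg m + off_deg g)%N.
Proof. by rewrite -big_split /=; apply: eq_bigr => i _; rewrite mnmDE. Qed.

Lemma off_deg1 i : off_deg U_(i) = (i != x).
Proof.
have := mdeg_off U_(i); rewrite mdeg1 mnm1E.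
by case: eqP => _ /=; lia.
Qed.

Lemma off_deg_le m g : (m <= g)%MM -> (off_deg m <= off_deg g)%N.
Proof. by move=> /mnm_lepP h; apply: leq_sum. Qed.

Lemma off_deg_var m : (0 < off_deg m)%N -> exists2 i, i != x & (U_(i) <= m)%MM.
Proof.
rewrite lt0n sum_nat_eq0 => /forall_inPn [i hi h].
by exists i => //; rewrite lep1mP.
Qed.

Lemma vallaJE : same_ideal (vallaJ (k := k) x) (mon_ideal (fun m => 1 <= off_deg m)%N).
Proof.
move=> p; split.
  apply: ideal_gen_min => [|_ [i hi ->]].
    by apply: mon_ideal_closed => m m' h; rewrite off_degD ltn_addr.
  by apply/mon_idealX; rewrite off_deg1 hi.
apply: mon_ideal_min => [|m /off_deg_var [i hi le]]; first exact: ideal_gen_closed.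
rewrite -(submK le) mpolyXD.
have [_ _] := ideal_gen_closed (fun p : R => exists2 i, i != x & p = 'X_i); apply.
by apply: ideal_gen_sub; exists i.
Qed.

Lemma vallaJ_expE j :
  same_ideal (ideal_exp (vallaJ (k := k) x) j) (mon_ideal (fun m => j <= off_deg m)%N).
Proof.
elim: j => [|j IH] p; first by split=> // _ m.
split.
  apply: ideal_gen_min => [|_ [f [g [/vallaJE hf /IH hg ->]]] m].
    by apply: mon_ideal_closed => m m' h; rewrite off_degD ltn_addr.
  move/msuppM_le/allpairsP => [[m1 m2] /= [/hf h1 /hg h2 ->]].
  by rewrite off_degD -add1n leq_add.
apply: mon_ideal_min => [|m hm]; first exact: ideal_gen_closed.
have [i hi le] : exists2 i, i != x & (U_(i) <= m)%MM.
  by apply: off_deg_var; apply: leq_ltn_trans hm.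
apply: ideal_gen_sub; exists 'X_i, 'X_[m - U_(i)]; split.
- by apply: ideal_gen_sub; exists i.
- apply/IH/mon_idealX; move: hm; rewrite -{1}(submK le) off_degD off_deg1 hi.
  by rewrite addn1.
- by rewrite -mpolyXD addmC submK.
Qed.

Lemma submonomial m e j :
  (e <= m x)%N -> (j <= off_deg m)%N ->
  exists g, [/\ (g <= m)%MM, g x = e & off_deg g = j].
Proof.
move=> he; move hd: (off_deg m - j)%N => d; elim: d m he hd => [|d IH] m he hd hj.
  have eo : off_deg m = j by apply/eqP; rewrite eqn_leq hj andbT -subn_eq0 hd.
  have le : (U_(x) *+ (m x - e) <= m)%MM.
    apply/mnm_lepP => i; rewrite mulmnE mnm1E; case: eqP => [<-|] //.
    by rewrite mul1n leq_subr.
  have hx : (m - U_(x) *+ (m x - e))%MM x = e.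
    by rewrite mnmBE mulmnE mnm1E eqxx mul1n subKn.
  exists (m - U_(x) *+ (m x - e))%MM; split=> //; first exact: lem_subr.
  rewrite -eo; apply: eq_bigr => i ne.
  by rewrite mnmBE mulmnE mnm1E eq_sym (negPf ne) subn0.
have [i hi le] : exists2 i, i != x & (U_(i) <= m)%MM.
  by apply: off_deg_var; apply: (@leq_ltn_trans j) => //; rewrite -subn_gt0 hd.
have eo : off_deg m = (off_deg (m - U_(i))).+1.
  by rewrite -{1}(submK le) off_degD off_deg1 hi addn1.
have [|||g [h1 h2 h3]] := IH (m - U_(i))%MM.
- by rewrite mnmBE mnm1E (negPf hi) subn0.
- by move: hd; rewrite eo; lia.
- by move: hd; rewrite eo; lia.
by exists g; split=> //; apply: lepm_trans h1 (lem_subr _ _).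
Qed.

Variables (a b : nat).
Hypotheses (b_gt0 : (0 < b)%N) (leba : (b <= a)%N).

(** The exponent of x in the generators x^c J^j of the Valla ideal. *)
Definition valla_exp (j : nat) : nat :=
  if (j < b)%N then (a + b - 2 * j)%N else (a - j)%N.

Lemma valla_exp_decr i j : (i < j)%N -> (j <= a)%N -> (valla_exp j < valla_exp i)%N.
Proof. by rewrite /valla_exp; case: ifP; case: ifP; lia. Qed.

Lemma valla_exp_inj i j :
  (i <= a)%N -> (j <= a)%N -> valla_exp i = valla_exp j -> i = j.
Proof.
move=> hi hj e; case: (ltngtP i j) => // lt.
- by have := valla_exp_decr lt hj; rewrite e ltnn.
- by have := valla_exp_decr lt hi; rewrite e ltnn.
Qed.

Lemma valla_exp_max : valla_exp a = 0%N.
Proof. by rewrite /valla_exp ltnNge leba subnn. Qed.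

Lemma valla_exp_le j : (j <= a)%N -> (valla_exp j + j <= a + b)%N.
Proof. by rewrite /valla_exp; case: ifP; lia. Qed.

(** The exponents of the monomials in the ideal: m is divisible by x^c v for
    some v of degree j in the other variables. *)
Definition in_valla m : Prop :=
  exists2 j, (j <= a)%N & (valla_exp j <= m x)%N /\ (j <= off_deg m)%N.

Lemma valla_idealE : same_ideal (valla_ideal (k := k) x a b) (mon_ideal in_valla).
Proof.
have up : upclosed in_valla.
  move=> m m' [j ja [h1 h2]]; exists j => //.
  by rewrite mnmDE off_degD; split; [apply: leq_trans h1 _|apply: leq_trans h2 _];
    apply: leq_addr.
have gen j (p : R) : (j <= a)%N -> vallaXJ x (valla_exp j) j p -> mon_ideal in_valla p.
  move=> ja [q /vallaJ_expE hq ->] m; rewrite mulrC mpolyXn (perm_mem (msuppMX _ _)).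
  move=> /mapP [m' /hq hm' ->]; exists j => //.
  rewrite mnmDE mulmnE mnm1E eqxx mul1n leq_addr off_degD; split=> //.
  by apply: leq_trans hm' (leq_addl _ _).
move=> p; split.
  apply: ideal_gen_min => [|q [[j jb hq]|[j /andP [bj ja] hq]]].
  - exact: mon_ideal_closed.
  - by apply: (gen j); [lia|rewrite /valla_exp jb].
  - by apply: (gen j) => //; rewrite /valla_exp ltnNge bj.
apply: mon_ideal_min => [|m [j ja [h1 h2]]]; first exact: ideal_gen_closed.
have hX : vallaXJ (k := k) x (valla_exp j) j 'X_[m].
  have le : (U_(x) *+ valla_exp j <= m)%MM.
    apply/mnm_lepP => i; rewrite mulmnE mnm1E; case: eqP => [<-|] //.
    by rewrite mul1n.
  exists 'X_[m - U_(x) *+ valla_exp j]; last by rewrite mpolyXn -mpolyXD addmC submK.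
  apply/vallaJ_expE/mon_idealX; move: h2; rewrite -{1}(submK le) off_degD.
  suff -> : off_deg (U_(x) *+ valla_exp j) = 0%N by rewrite addn0.
  by apply: big1 => i ne; rewrite mulmnE mnm1E eq_sym (negPf ne).
apply: ideal_gen_sub; move: hX; rewrite /valla_exp; case: ltnP => hj h.
  by left; exists j.
by right; exists j => //; rewrite hj.
Qed.

(** All generators have total degree at most a + b, which makes the set
    finite. *)
Definition valla_gens : {fset 'X_{1..n}} :=
  [fset bmnm m | m : 'X_{1..n < (a + b).+1} &
    (off_deg (bmnm m) <= a)%N && (bmnm m x == valla_exp (off_deg (bmnm m)))]%fset.

Lemma valla_gensP m :
  reflect ((off_deg m <= a)%N /\ m x = valla_exp (off_deg m)) (m \in valla_gens).
Proof.
apply: (iffP idP) => [/imfsetP [m' /= + ->]|[h1 h2]].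
  by rewrite inE => /andP [? /eqP ?].
have hd : (mdeg m < (a + b).+1)%N by rewrite ltnS mdeg_off h2 valla_exp_le.
by apply/imfsetP; exists (BMultinom hd) => //=; rewrite inE /= h1 h2 eqxx.
Qed.

(** If g divides h, then off [x] the degree of h is at least that of g.  Were
    it larger, the exponent of [x] in h would be smaller than in g.  So the two
    degrees agree, and g = h. *)
Lemma valla_gens_antichain : antichain valla_gens.
Proof.
move=> g h /valla_gensP [ga gx] /valla_gensP [ha hx] le.
have hoff : off_deg g = off_deg h.
  apply/eqP; rewrite eqn_leq off_deg_le //= leqNgt; apply/negP => lt.
  have := valla_exp_decr lt ha; rewrite -gx -hx ltnNge.
  by move/mnm_lepP: le => ->.
have e : mdeg g = mdeg h by rewrite !mdeg_off gx hx hoff.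
have : mdeg (h - g + g)%MM = mdeg h by rewrite submK.
rewrite mdegD e => /(canRL (addnK _)) /eqP; rewrite subnn mdeg_eq0 => /eqP h0.
by rewrite -(submK le) h0 add0m.
Qed.

Lemma upset_valla_gens m : upset valla_gens m <-> in_valla m.
Proof.
split=> [[g /valla_gensP [ga gx] le]|[j ja [h1 h2]]].
  exists (off_deg g) => //; rewrite off_deg_le // -gx.
  by move/mnm_lepP: le => ->.
have [g [le gx go]] := submonomial h1 h2.
by exists g => //; apply/valla_gensP; rewrite go gx.
Qed.

Lemma valla_gens_neq0 : valla_gens != fset0.
Proof.
have [] : upset valla_gens (U_(x) *+ valla_exp 0)%MM.
  apply/upset_valla_gens; exists 0%N => //.
  by rewrite mulmnE mnm1E eqxx mul1n.
by move=> g hg _; apply/fset0Pn; exists g.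
Qed.

Hypothesis x_first : forall i : 'I_n, (x <= i)%N.

(** Trading x for x_i passes from j to j + 1 and lowers the exponent of x by one
    only, but c_(j+1) < c_j.  If x does not occur in m, then j = a and the
    exchange takes place within J^a. *)
Lemma valla_gens_stable m : m \in valla_gens ->
  forall p i : 'I_n, (p < i)%N -> m p != 0%N ->
  (forall q : 'I_n, (q < p)%N -> m q = 0%N) ->
  upset valla_gens (m + U_(i) - U_(p))%MM.
Proof.
move=> /valla_gensP [ma mx] p i ltpi hp hq; apply/upset_valla_gens.
have ne : i != x by rewrite -val_eqE /= gtn_eqF // (leq_ltn_trans (x_first p)).
have le : (U_(p) <= m + U_(i))%MM.
  by apply: lepm_trans (lem_addr _ _); rewrite lep1mP.
move: (submK le); set u := (_ - _)%MM => eu.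
have ux : (u x + (p == x))%N = m x.
  have /mnmP/(_ x) := eu; rewrite !mnmDE !mnm1E (negPf ne) addn0; exact.
have uo : (off_deg u + (p != x))%N = (off_deg m).+1.
  by rewrite -off_deg1 -off_degD eu off_degD off_deg1 ne addn1.
have [epx|npx] := eqVneq p x.
  rewrite epx eqxx /= in ux uo hp.
  have lta : (off_deg m < a)%N.
    rewrite ltn_neqAle ma andbT; apply/eqP => e.
    by rewrite mx e valla_exp_max in hp.
  exists (off_deg m).+1 => //; split; last by rewrite -uo addn0.
  by have := valla_exp_decr (ltnSn _) lta; rewrite -mx -ux addn1.
rewrite (negPf npx) /= in ux uo.
have m0 : m x = 0%N.
  by apply: hq; rewrite ltn_neqAle x_first andbT val_eqE eq_sym.
have ea : off_deg m = a.
  apply/eqP; rewrite eqn_leq ma leqNgt; apply/negP => lta.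
  by have := valla_exp_decr lta (leqnn a); rewrite -mx m0.
exists a => //; rewrite valla_exp_max; split=> //.
by move: uo; rewrite addn1 ea => -[->].
Qed.

(** The exponent of [x] in alpha is c_j, which determines j by strict
    monotonicity; the degree of alpha off [x] is j plus the length of the
    list. *)
Lemma valla_length_unique m m' (T T' : seq 'I_n) alpha :
  m \in valla_gens -> m' \in valla_gens ->
  x \notin T -> x \notin T' ->
  alpha = (m + \sum_(j <- T) U_(j))%MM -> alpha = (m' + \sum_(j <- T') U_(j))%MM ->
  size T = size T'.
Proof.
have aux g (S : seq 'I_n) : x \notin S ->
    (g + \sum_(j <- S) U_(j))%MM x = g x /\
    off_deg (g + \sum_(j <- S) U_(j))%MM = (off_deg g + size S)%N.
  elim: S => [|s S IH] in g *; first by rewrite big_nil addm0 addn0.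
  rewrite inE negb_or big_cons addmA => /andP [ne /IH h].
  have [-> ->] := h (g + U_(s))%MM.
  by rewrite mnmDE mnm1E off_degD off_deg1 [s == x]eq_sym (negPf ne) addn0 -addnA.
move=> /valla_gensP [ma mx] /valla_gensP [ma' mx'] /(aux m) [h1 h2].
move=> /(aux m') [h1' h2'] -> e.
rewrite e in h1 h2; have eo : off_deg m = off_deg m'.
  by apply: valla_exp_inj; rewrite // -mx -mx' -h1 -h1'.
by apply/(@addnI (off_deg m)); rewrite -h2 h2' eo.
Qed.

Lemma valla_MV_type_B2 : MV_type_B2 (valla_ideal (k := k) x a b).
Proof.
have [t ht hb] :=
  stable_MVT k valla_gens_neq0 valla_gens_antichain valla_gens_stable.
apply: (@MV_type_B2_disjoint _ _ t).
  apply: is_MVT_same ht; apply: same_ideal_trans (monomial_idealE _) _.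
  apply: same_ideal_trans (same_ideal_sym valla_idealE).
  by apply/mon_ideal_same/upset_valla_gens.
move=> i alpha /hb [m [T [hm sT eT hT]]]; apply/eqP; rewrite -leqn0 leqNgt.
apply/negP => /hb [m' [T' [hm' sT' eT' hT']]].
have notx (S : seq 'I_n) g :
    (forall j, j \in S -> exists2 p : 'I_n, (p < j)%N & g p != 0%N) ->
    x \notin S.
  by move=> h; apply/negP => /h [p]; rewrite ltnNge x_first.
have := valla_length_unique hm hm' (notx _ _ hT) (notx _ _ hT') eT eT'.
by rewrite sT sT' => /eqP; rewrite gtn_eqF.
Qed.

End Valla.

Theorem proposition4p1p13 (k : fieldType) (hk : [pchar k]%R =i pred0)
    (n : nat) (hn : (1 < n)%N) (a b : nat) (hb : (0 < b)%N) (hab : (b <= a)%N) :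
  MV_type_B2 (@valla_ideal k n (Ordinal (ltnW hn)) a b).
Proof. exact: valla_MV_type_B2. Qed.
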